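(* Let $k$ be a field of characteristic $p>0$. The conjugacy classes in $\mathrm{BAs}_2(k)$ are those of (1) $(x,y+\lambda)$ where $\lambda\in k$; (2) $(x+f(y),y)$ where $f\in k[y]$, $f\neq0$, and $f$ is a unique representative in $k[y]/k$, the orbit space of the action $k\times k[y]\to k[y]$ given by $\lambda\cdot g(y)=g(y+\lambda)$; (3) $(x+y^{p-1}f(y^p),y+\lambda)$ where $\lambda\in k^*$ and $f\neq0$ is a one-variable polynomial over $k$.
   Context: $\mathrm{BAs}_2(k)$ is the group (under composition) of strictly triangular polynomial maps $(x+f,y+c)$ with $f\in k[y]$, $c\in k$. Conjugacy is conjugacy in this group. ''A unique representative'' means that a system of representatives of the orbits is fixed once and for all and $f$ is required to lie in it. *)

(* Defs.v *)
From HB Require Import structures.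
From mathcomp Require Import all_boot all_algebra.
From mathcomp Require Import mpoly ring.

Set Implicit Arguments.
Unset Strict Implicit.
Unset Printing Implicit Defensive.

Import GRing.Theory.
Local Open Scope ring_scope.

(* [PolyMap f c] encodes the strictly triangular map (x + f(y), y + c); see
   [polymap_of] below. *)
Record BAs2 (k : fieldType) := PolyMap { ypart : {poly k}; shift : k }.

Section Group.
Variable k : fieldType.
Implicit Types u v w : BAs2 k.

Definition pair_of_BAs2 u := (ypart u, shift u).
Definition BAs2_of_pair (a : {poly k} * k) := PolyMap a.1 a.2.
Lemma pair_of_BAs2K : cancel pair_of_BAs2 BAs2_of_pair.
Proof. by case. Qed.

HB.instance Definition _ := Choice.copy (BAs2 k) (can_type pair_of_BAs2K).

(* The action of (k, +) on k[y]: lam . g = g(y + lam). *)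
Definition translate (lam : k) (g : {poly k}) : {poly k} :=
  g \Po ('X + lam%:P).

Definition BAs2_one : BAs2 k := PolyMap 0 0.

(* u o v: with v = (x + g(y), y + d), substituting gives
   (x + g(y) + f(y + d), y + d + c). *)
Definition BAs2_mul u v : BAs2 k :=
  PolyMap (ypart v + translate (shift v) (ypart u)) (shift v + shift u).

Definition BAs2_inv u : BAs2 k :=
  PolyMap (- translate (- shift u) (ypart u)) (- shift u).

Lemma translate0 g : translate 0 g = g.
Proof. by rewrite /translate addr0 comp_polyXr. Qed.

Lemma translateD a b g : translate a (translate b g) = translate (a + b) g.
Proof.
by rewrite /translate -comp_polyA comp_polyD comp_polyX comp_polyC polyCD addrA.
Qed.

Lemma BAs2_mulA : associative BAs2_mul.
Proof.
case=> f a [g b] [h c]; rewrite /BAs2_mul /=; congr PolyMap; last first.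
  by rewrite addrA.
by rewrite [in RHS]/translate comp_polyD -!/(translate _ _) translateD addrA.
Qed.

Lemma BAs2_mul1 : left_id BAs2_one BAs2_mul.
Proof. by case=> f a; rewrite /BAs2_mul /= /translate comp_poly0 !addr0. Qed.

Lemma BAs2_mulr1 : right_id BAs2_one BAs2_mul.
Proof. by case=> f a; rewrite /BAs2_mul /= translate0 !add0r. Qed.

Lemma BAs2_mulV : left_inverse BAs2_one BAs2_inv BAs2_mul.
Proof.
case=> f a; rewrite /BAs2_mul /BAs2_inv /=; congr PolyMap; last exact: subrr.
rewrite [X in _ + X]/translate raddfN /= -!/(translate _ _) translateD subrr.
by rewrite translate0 subrr.
Qed.

Lemma BAs2_mulrV : right_inverse BAs2_one BAs2_inv BAs2_mul.
Proof.
case=> f a; rewrite /BAs2_mul /BAs2_inv /=; congr PolyMap; last exact: addNr.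
by rewrite addNr.
Qed.

HB.instance Definition _ := isGroup.Build (BAs2 k)
  BAs2_mulA BAs2_mul1 BAs2_mulr1 BAs2_mulV BAs2_mulrV.

(* Polynomial maps of the plane, as pairs (F_x, F_y) in k[x, y]; here
   x = 'X_0, y = 'X_1 and composition is formal substitution (the field may be
   finite, so these are not functions on points). *)
Definition polymap := 2.-tuple {mpoly k[2]}.

Definition polymap_id : polymap := [tuple 'X_i | i < 2].

Definition polymap_comp (F G : polymap) : polymap :=
  [tuple tnth F i \mPo G | i < 2].

Definition polymap_of u : polymap :=
  [tuple 'X_0 + horner_alg 'X_1 (ypart u); 'X_1 + (shift u)%:MP].

Lemma horner_algX_sum (A : comAlgType k) (a : A) (f : {poly k}) :
  horner_alg a f = \sum_(i < size f) f`_i *: a ^+ i.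
Proof.
rewrite -[in LHS](coefK f) poly_def raddf_sum /=; apply: eq_bigr => i _.
rewrite -mul_polyC rmorphM /= horner_algC rmorphXn /= horner_algX.
by rewrite mulr_algl.
Qed.

Lemma polymap_of_inj : injective polymap_of.
Proof.
move=> [f a] [g b] E.
have E0 := congr1 (fun t : polymap => tnth t ord0) E.
have E1 := congr1 (fun t : polymap => tnth t ord_max) E.
move: E0 E1; rewrite !(tnth_nth 0) /= => /addrI E0 /addrI /(congr1 (mcoeff 0%MM)).
rewrite !mcoeffC eqxx !mulr1 => ->.
congr PolyMap; move/(congr1 (mmap (@polyC k) (fun=> 'X))): E0.
have H h : mmap (@polyC k) (fun=> 'X)
             (horner_alg ('X_1 : {mpoly k[2]}) h) = h.
  rewrite horner_algX_sum raddf_sum /= -[RHS]coefK poly_def.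
  apply: eq_bigr => i _.
  by rewrite mmapZ rmorphXn /= mmapX mmap1U mul_polyC.
by rewrite !H.
Qed.

Lemma polymap_of1 : polymap_of 1%g = polymap_id.
Proof.
apply: eq_from_tnth => i; rewrite tnth_map tnth_ord_tuple.
rewrite (tnth_nth 0) /=; case: i => [[|[|//]] Hi] /=.
  by rewrite raddf0 addr0; congr ('X_ _); apply: val_inj.
by rewrite mpolyC0 addr0; congr ('X_ _); apply: val_inj.
Qed.

Lemma horner_alg_comp_mpoly (f : {poly k}) (F : polymap) :
  horner_alg ('X_1 : {mpoly k[2]}) f \mPo F = horner_alg (F`_1) f.
Proof.
rewrite !horner_algX_sum raddf_sum /=; apply: eq_bigr => i _.
by rewrite comp_mpolyZ rmorphXn /= comp_mpolyXU.
Qed.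

Lemma horner_alg_translate (A : comAlgType k) (a : A) c (f : {poly k}) :
  horner_alg a (translate c f) = horner_alg (a + c%:A) f.
Proof.
rewrite /translate [in RHS]horner_algX_sum comp_polyE raddf_sum /=.
apply: eq_bigr => i _.
rewrite -mul_polyC rmorphM /= horner_algC rmorphXn /= raddfD /=.
by rewrite horner_algX horner_algC mulr_algl.
Qed.

Lemma polymap_ofM u v :
  polymap_of (u * v)%g = polymap_comp (polymap_of u) (polymap_of v).
Proof.
apply: eq_from_tnth => i; rewrite tnth_map tnth_ord_tuple.
rewrite !(tnth_nth 0) /=; case: i => [[|[|//]] Hi] /=.
  rewrite comp_mpolyD horner_alg_comp_mpoly comp_mpolyXU /= -addrA.
  by rewrite raddfD /= horner_alg_translate alg_mpolyC.
by rewrite comp_mpolyD comp_mpolyC comp_mpolyXU /= mpolyCD addrA.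
Qed.

Definition conjugate u v := exists w, v = (u ^ w)%g.

(* A system of representatives for the orbits of translate. *)
Definition orbit_representatives (S : {poly k} -> Prop) :=
  forall g, exists! f, S f /\ exists lam, f = translate lam g.

Definition translation_form u := exists lam, u = PolyMap 0 lam.

Definition shear_form (S : {poly k} -> Prop) u :=
  exists f, [/\ f != 0, S f & u = PolyMap f 0].

(* Distinct f with the same lam may give conjugate maps: in characteristic 2,
   (x + y^3, y + 1) is conjugate to (x + y(y^2 + d^2 + d), y + 1) for all d. *)
Definition mixed_form (p : nat) u := exists lam f,
  [/\ lam != 0, f != 0 & u = PolyMap ('X^(p.-1) * (f \Po 'X^p)) lam].

Definition normal_form p S u :=
  [\/ translation_form u, shear_form S u | mixed_form p u].

Lemma mixed_form_conj2 (d : k) : 2%N \in [pchar k] ->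
  conjugate (PolyMap ('X * ('X \Po 'X^2)) 1)
            (PolyMap ('X * (('X + (d ^+ 2 + d)%:P) \Po 'X^2)) 1).
Proof.
move=> /pcharf0 two0; pose D := d%:P.
exists (PolyMap (D * 'X^3 + (D ^+ 3 + D) * 'X) d).
rewrite conjgE; apply/(canRL (mulKg _)); congr PolyMap; last exact: addrC.
have -> : (d ^+ 2 + d)%:P = D ^+ 2 + D by rewrite polyCD polyC_exp.
rewrite /= /translate !(comp_polyD, comp_polyM, comp_polyX, comp_polyC,
  comp_Xn_poly, rmorphXn) /= -/D polyC1.
have P0 : 2%:R = 0 :> {poly k} by rewrite -polyC_natr two0.
apply/eqP; rewrite -subr_eq0; apply/eqP.
transitivity (2%:R * (D + 2%:R * D * 'X - 'X * D ^+ 2)); last first.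
  by rewrite P0 mul0r.
ring.
Qed.

End Group.

(* Main.v *)
(** Conjugating [(x + f, y + c)] by [(x + h, y + d)] keeps [c] and replaces [f]
    by [f(y + d) + h - h(y + c)].  If [c = 0] only translations of [f] are left.
    If [c <> 0], the differences [h(y + c) - h] absorb every monomial [y^n] with
    [p] not dividing [n + 1], since [(y + c)^(n + 1) - y^(n + 1)] has leading
    term [(n + 1) c y^n]; what remains is [y^(p-1) q(y^p)].  Such a remainder is
    a difference only if [q = 0]: the trace [sum_(i < p) g(y + i c)] vanishes on
    differences, whereas for [g = y^(p-1) q(y^p)] with [deg q = m] its
    coefficient at [y^(p m)] is [- c^(p-1) lead(q)]. *)
Require Import Defs.
From mathcomp Require Import all_boot all_algebra.
Import GRing.Theory.
Local Open Scope ring_scope.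

Section Translate.
Variable k : fieldType.
Implicit Types (a c lam : k) (f g h : {poly k}).

Lemma translateB lam f g :
  translate lam (f - g) = translate lam f - translate lam g.
Proof. exact: comp_polyB. Qed.

Lemma size_translate lam f : size (translate lam f) = size f.
Proof. by rewrite size_comp_poly2 // size_XaddC. Qed.

Lemma translate_eq0 lam f : (translate lam f == 0) = (f == 0).
Proof. by rewrite -!size_poly_eq0 size_translate. Qed.

Lemma lead_coef_translate lam f : lead_coef (translate lam f) = lead_coef f.
Proof.
by rewrite lead_coef_comp ?size_XaddC // lead_coefXaddC expr1n mulr1.
Qed.

Lemma translate_Xn lam n : translate lam ('X^n) = ('X + lam%:P) ^+ n.
Proof. exact: comp_Xn_poly. Qed.

Lemma conjugateP (u v : BAs2 k) : conjugate u v <->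
  shift v = shift u /\ exists d h,
    ypart v = translate d (ypart u) + h - translate (shift u) h.
Proof.
case: u v => [f c] [g e] /=; split.
  (* With [w] the conjugator, [v = u ^ w] becomes [w * v = u * w], so no inverse has to be
     expanded. *)
  case=> -[h d]; rewrite conjgE => /(canLR (mulVKg _)).
  move/(congr1 (@pair_of_BAs2 k)).
  rewrite /pair_of_BAs2 /= => -[E1 E2].
  have ec : e = c by apply: (@addIr _ d); rewrite E2 addrC.
  split=> //; exists d, h; apply: (@addIr _ (translate e h)).
  by rewrite E1 ec subrK addrC.
case=> -> [d [h ->]]; exists (PolyMap h d).
rewrite conjgE; apply/(canRL (mulKg _)); congr PolyMap; last exact: addrC.
by rewrite /= subrK addrC.
Qed.

Lemma conjugate_sym (u v : BAs2 k) : conjugate u v -> conjugate v u.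
Proof. by case=> w ->; exists w^-1%g; rewrite conjgK. Qed.

End Translate.

Section Characteristic.
Variables (k : fieldType) (p : nat).
Hypothesis charkp : p \in [pchar k].
Implicit Types (c : k) (f g h q : {poly k}).

Let p_prime : prime p := pcharf_prime charkp.
Let p_gt0 : (0 < p)%N := prime_gt0 p_prime.

(** The polynomials whose monomials [y^n] all have [p] dividing [n + 1]. *)
Definition sparse q : {poly k} := 'X^(p.-1) * (q \Po 'X^p).

(** The two subtracted terms are the top two of the binomial expansion of [(y + c)^(n+1)]. *)
Lemma size_translate_XnB c n :
  (size (translate c 'X^(n.+1) - 'X^(n.+1) - (c *+ n.+1) *: 'X^n)%R <= n)%N.
Proof.
apply/leq_sizeP => j le_nj; rewrite translate_Xn !coefB coefZ !coefXn.
rewrite ['X + _]addrC exprDn coef_sum.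
have cX (i : 'I_n.+2) :
    (c%:P ^+ (n.+1 - i) * 'X^i *+ 'C(n.+1, i))`_j
    = c ^+ (n.+1 - i) *+ 'C(n.+1, i) *+ (j == i)%N.
  by rewrite coefMn -polyC_exp coefCM coefXn mulr_natr -!mulrnA mulnC.
under eq_bigr do rewrite cX.
rewrite 2!big_ord_recr /= big1 ?add0r => [|i _]; last first.
  by rewrite gtn_eqF ?mulr0n // (leq_trans (ltn_ord i)).
rewrite subnn subSnn binn binSn expr0 expr1 mulr1n.
have [->|ne_jn] := eqVneq j n.
  by rewrite ltn_eqF // !mulr0n addr0 subr0 mulr1 mulr1n subrr.
by rewrite mulr0n add0r mulr0 subr0 subrr.
Qed.

Lemma difference_add_sparse c f : c != 0 ->
  exists h q, f = translate c h - h + sparse q.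
Proof.
move=> c0; have [n] := ubnP (size f); elim: n f => // n IHn f.
rewrite ltnS => le_fn.
have [lt_fn|] := ltnP (size f) n; first exact: IHn.
case: n => [|n] in IHn le_fn *.
  rewrite size_poly_leq0 in le_fn *; move: le_fn => /eqP -> _.
  exists 0, 0; rewrite /sparse /translate !comp_poly0.
  by rewrite mulr0 subrr addr0.
move=> ge_fn; set b := f`_n.
(* The required form is closed under addition, so it is enough to cancel the coefficient of
   [y^n]. *)
suff [r [h [q [size_r rE]]]] : exists r h q,
    (size (f - r)%R <= n)%N /\ r = translate c h - h + sparse q.
  have [h' [q' fE]] := IHn _ (size_r : (size _ < n.+1)%N).
  exists (h' + h), (q' + q); rewrite -(subrK r f) fE rE /sparse.
  rewrite /translate !comp_polyD mulrDr addrACA; congr (_ + _).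
  by rewrite addrACA -opprD.
have size_top : (size (f - b *: 'X^n)%R <= n)%N.
  apply/leq_sizeP => j le_nj; rewrite coefB coefZ coefXn.
  have [->|ne_jn] := eqVneq j n; first by rewrite mulr1 subrr.
  rewrite mulr0 subr0; move/leq_sizeP: le_fn; apply.
  by rewrite ltn_neqAle eq_sym ne_jn.
(* If [p] divides [n + 1], then [y^n] is itself sparse, as [n = (p - 1) + p ((n + 1)/p - 1)].
   Otherwise [e = (n + 1) c] is invertible, and the difference of [(b / e) y^(n+1)] has leading term
   [b y^n]. *)
have [dvd_p|ndvd_p] := boolP (p %| n.+1)%N.
  exists (b *: 'X^n), 0, (b *: 'X^((n.+1 %/ p)%N.-1)); split=> //.
  rewrite /translate comp_poly0 subrr add0r /sparse comp_polyZ.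
  rewrite comp_Xn_poly -exprM -scalerAr -exprD; congr (_ *: 'X^_).
  apply/eqP; rewrite -eqSS -addSn prednK // -mulnS prednK.
    by rewrite mulnC divnK.
  by rewrite divn_gt0 // dvdn_leq.
set e := c *+ n.+1.
have e0 : e != 0.
  by rewrite /e -mulr_natr mulf_neq0 // -(dvdn_pcharf charkp).
exists ((b / e) *: (translate c 'X^(n.+1) - 'X^(n.+1))).
exists ((b / e) *: 'X^(n.+1)), 0.
split; last first.
  by rewrite /sparse comp_poly0 mulr0 addr0 /translate comp_polyZ scalerBr.
have -> : f - (b / e) *: (translate c 'X^(n.+1) - 'X^(n.+1)) =
    f - b *: 'X^n - (b / e) *: (translate c 'X^(n.+1) - 'X^(n.+1) - e *: 'X^n).
  rewrite [in RHS]scalerBr scalerA divfK // opprB addrA.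
  by rewrite subrK.
apply: leq_trans (size_polyD _ _) _; rewrite geq_max size_top size_polyN /=.
exact: leq_trans (size_scale_leq _ _) (size_translate_XnB c n).
Qed.

(** The sum telescopes to [h(y + p c) - h(y)], and [p c = 0]. *)
Lemma trace_difference c h :
  \sum_(0 <= i < p) translate (c *+ i) (translate c h - h) = 0.
Proof.
under eq_bigr do rewrite translateB translateD -mulrSr.
rewrite (telescope_sumr (fun i => translate (c *+ i) h)) // mulr0n.
by rewrite -mulr_natr (pcharf0 charkp) mulr0 subrr.
Qed.

(** By Fermat each of the [p - 1] terms with [i > 0] equals 1; the term [i = 0] vanishes because
    [p - 1 > 0]. *)
Lemma sum_natr_expr_pred : \sum_(0 <= i < p) (i%:R : k) ^+ p.-1 = -1.
Proof.
have p1 : p.-1 != 0%N by rewrite -lt0n -ltnS prednK // prime_gt1.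
rewrite big_ltn // expr0n (negPf p1) add0r.
rewrite (eq_big_nat _ _ (F2 := fun=> 1)) => [|i /andP[i_gt0 lt_ip]].
  rewrite sumr_const_nat subn1; apply/eqP; rewrite -subr_eq0 opprK -mulrSr.
  by rewrite prednK // (pcharf0 charkp).
have i0 : (i%:R : k) != 0.
  by rewrite -(dvdn_pcharf charkp) gtnNdvd.
apply: (mulIf i0); rewrite mul1r -exprSr prednK //.
by rewrite -[LHS](pFrobenius_autE charkp) pFrobenius_aut_nat.
Qed.

(** Since [(y + c)^p = y^p + c^p], translating [q(y^p)] by [c] amounts to translating [q] by
    [c^p]. *)
Lemma translate_sparse c q : translate c (sparse q) =
  ('X + c%:P) ^+ p.-1 * (translate (c ^+ p) q \Po 'X^p).
Proof.
have charP : p \in [pchar {poly k}] by rewrite pchar_poly.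
rewrite /sparse {1}/translate comp_polyM comp_Xn_poly; congr (_ * _).
rewrite /translate -!comp_polyA comp_Xn_poly comp_polyD comp_polyX comp_polyC.
by rewrite polyC_exp -!(pFrobenius_autE charP) rmorphD.
Qed.

Lemma coef_translate_sparse c q :
  (translate c (sparse q))`_(p * (size q).-1) = c ^+ p.-1 * lead_coef q.
Proof.
rewrite translate_sparse coefM big_ord_recl /= subn0 big1 ?addr0.
  rewrite coef_comp_poly_Xn // dvdn_mulr // mulKn //; congr (_ * _).
    by rewrite -horner_coef0 horner_exp !hornerE.
  rewrite -(lead_coef_translate _ (c ^+ p) q) /lead_coef.
  by rewrite size_translate.
move=> i _; rewrite /bump add1n coef_comp_poly_Xn //.
have le_i : (i.+1 <= p * (size q).-1)%N by [].
rewrite dvdn_subr ?dvdn_mulr //.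
(* Only exponents divisible by [p] contribute from [(y + c)^(p-1)]; a positive one exceeds its
   degree, which leaves the constant term. *)
have [lt_ip|le_pi] := ltnP i.+1 p; first by rewrite gtnNdvd // mulr0.
rewrite nth_default ?mul0r // -[c]opprK polyCN size_exp_XsubC.
by rewrite prednK.
Qed.

Lemma sparse_difference_eq0 c h q : c != 0 ->
  sparse q = translate c h - h -> q = 0.
Proof.
move=> c0 qE; have := trace_difference c h; rewrite -qE.
move/(congr1 (fun g : {poly k} => g`_(p * (size q).-1))).
rewrite coef_sum coef0.
under eq_bigr do rewrite coef_translate_sparse -mulr_natr exprMn mulrAC.
rewrite -mulr_sumr sum_natr_expr_pred mulrN1 => /eqP.
by rewrite oppr_eq0 mulf_eq0 expf_eq0 (negPf c0) andbF lead_coef_eq0 => /eqP.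
Qed.

Lemma translation_mixed_not_conjugate (u v : BAs2 k) :
  translation_form u -> mixed_form p v -> ~ conjugate u v.
Proof.
move=> [a ->] [c [q [c0 q0 ->]]] /conjugateP [/= ca [d [h]]].
rewrite -ca {1}/translate comp_poly0 add0r => hE.
(* Conjugation contributes [h - h(y + c)], the difference of [- h]. *)
move/eqP: q0; apply; apply: (sparse_difference_eq0 c (- h)) => //.
by rewrite /sparse hE /translate raddfN /= opprK addrC.
Qed.

Lemma translation_shear_not_conjugate (S : {poly k} -> Prop) (u v : BAs2 k) :
  translation_form u -> shear_form S v -> ~ conjugate u v.
Proof.
move=> [a ->] [f [f0 _ ->]] /conjugateP [/= <- [d [h fE]]].
by move: f0; rewrite fE translate0 addrK translate_eq0 eqxx.
Qed.

Lemma shear_mixed_not_conjugate (S : {poly k} -> Prop) (u v : BAs2 k) :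
  shear_form S u -> mixed_form p v -> ~ conjugate u v.
Proof.
move=> [f [_ _ ->]] [c [q [c0 _ ->]]] /conjugateP [/= cE _].
by rewrite cE eqxx in c0.
Qed.

Lemma normal_form_exists (S : {poly k} -> Prop) (u : BAs2 k) :
  orbit_representatives S -> exists2 v, normal_form p S v & conjugate u v.
Proof.
move=> HS; case: u => f c; have [->|c0] := eqVneq c 0.
  have [->|f0] := eqVneq f 0.
    exists (PolyMap 0 0); first by constructor 1; exists 0.
    by exists 1%g; rewrite conjg1.
  have [g [[Sg [d gE]] _]] := HS f.
  exists (PolyMap g 0).
    by constructor 2; exists g; split; rewrite // gE translate_eq0.
  by apply/conjugateP; split=> //; exists d, 0; rewrite translate0 addrK.
have [h [q fE]] := difference_add_sparse c f c0.
exists (PolyMap (sparse q) c).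
  have [->|q0] := eqVneq q 0; last by constructor 3; exists c, q.
  by constructor 1; exists c; rewrite /sparse comp_poly0 mulr0.
(* Conjugating by [(x + h, y)] removes exactly the difference part of [f]. *)
apply/conjugateP; split=> //; exists 0, h => /=.
rewrite translate0; apply/(canRL (addrK _)).
by rewrite fE [RHS]addrAC subrK addrC.
Qed.

(** Two conjugate mixed forms are only shown to share the shift: a conjugator with [d != 0] may
    change the sparse part. *)
Lemma normal_form_unique (S : {poly k} -> Prop) (u v : BAs2 k) :
  orbit_representatives S -> normal_form p S u -> normal_form p S v ->
  conjugate u v ->
  u = v \/ [/\ mixed_form p u, mixed_form p v & shift u = shift v].
Proof.
move=> HS [Tu|Su|Mu] [Tv|Sv|Mv] uv; have vu := conjugate_sym _ _ _ uv.
- case: Tu Tv uv => [a ->] [b ->] /conjugateP [/= -> _]; by left.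
- by case: (translation_shear_not_conjugate _ _ _ Tu Sv uv).
- by case: (translation_mixed_not_conjugate _ _ Tu Mv uv).
- by case: (translation_shear_not_conjugate _ _ _ Tv Su vu).
- case: Su Sv uv => [f [_ Sf ->]] [g [_ Sg ->]] /conjugateP [_ [d [h /= gE]]].
  left; rewrite translate0 addrK in gE.
  (* Both [f] (translation by 0) and [g] (translation by [d]) are representatives of the orbit of
     [f], so both equal [r]. *)
  have [r [_ r_unique]] := HS f; congr PolyMap; rewrite -(r_unique g).
    by rewrite -(r_unique f) //; split=> //; exists 0; rewrite translate0.
  by split=> //; exists d.
- by case: (shear_mixed_not_conjugate _ _ _ Su Mv uv).
- by case: (translation_mixed_not_conjugate _ _ Tv Mu vu).
- by case: (shear_mixed_not_conjugate _ _ _ Sv Mu vu).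
- by right; split=> //; case/conjugateP: uv.
Qed.

End Characteristic.

Theorem corollary4p1 (k : fieldType) (p : nat) (charkp : p \in [pchar k])
    (S : {poly k} -> Prop) (HS : orbit_representatives S) :
  (forall u : BAs2 k, exists2 v, normal_form p S v & conjugate u v) /\
  (forall u v : BAs2 k, normal_form p S u -> normal_form p S v ->
     conjugate u v ->
     u = v \/ [/\ mixed_form p u, mixed_form p v & shift u = shift v]).
Proof.
split=> [u|u v]; first exact: normal_form_exists.
exact: normal_form_unique.
Qed.
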